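(* Let $f$ be a shift-invariant left interval-specification on $(\Omega,\mathcal{F})$. (a) A chain $\mu\in\mathcal{G}_{\mathrm{inv}}(f)$ is extreme in $\mathcal{G}_{\mathrm{inv}}(f)$ if and only if $\mu$ is ergodic. (b) Let $\mu\in\mathcal{G}_{\mathrm{inv}}(f)$. If $\nu\in\mathcal{P}_{\mathrm{inv}}(\Omega,\mathcal{F})$ is such that $\nu\ll\mu$, then $\nu\in\mathcal{G}_{\mathrm{inv}}(f)$. (c) $\mathcal{G}_{\mathrm{inv}}(f)$ is a face of $\mathcal{P}_{\mathrm{inv}}(\Omega,\mathcal{F})$. More precisely, if $\mu,\nu\in\mathcal{P}_{\mathrm{inv}}(\Omega,\mathcal{F})$ and $0<s<1$ are such that $s\mu+(1-s)\nu\in\mathcal{G}_{\mathrm{inv}}(f)$, then $\mu,\nu\in\mathcal{G}_{\mathrm{inv}}(f)$.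
   Context: Let $(E,\mathcal{E})$ be a measurable space and $\Omega\subset E^{\mathbb{Z}}$ a set of (admissible) configurations, endowed with the $\sigma$-algebra $\mathcal{F}$ which is the restriction to $\Omega$ of the product $\sigma$-algebra. For $\Lambda\subset\mathbb{Z}$, $\mathcal{F}_\Lambda\subset\mathcal{F}$ is the $\sigma$-algebra generated by the coordinates $\omega\mapsto\omega_i$, $i\in\Lambda$; $\mathcal{F}_{\le n}=\mathcal{F}_{]-\infty,n]}$. $\mathcal{S}_b$ is the set of (nonempty) finite intervals of $\mathbb{Z}$; for $\Lambda\in\mathcal{S}_b$, $l_\Lambda=\min\Lambda$, $m_\Lambda=\max\Lambda$, $\Lambda_-=\,]-\infty,l_\Lambda-1]$. A left interval-specification (LIS) on $(\Omega,\mathcal{F})$ is a family $f=\{f_\Lambda\}_{\Lambda\in\mathcal{S}_b}$ of probability kernels $f_\Lambda:\mathcal{F}_{\le m_\Lambda}\times\Omega\to[0,1]$ (so $f_\Lambda(\cdot\mid\omega)$ is a probability measure on $(\Omega,\mathcal{F}_{\le m_\Lambda})$) such that for all $\Lambda\in\mathcal{S}_b$: (a) for each $A\in\mathcal{F}_{\le m_\Lambda}$, $f_\Lambda(A\mid\cdot)$ is $\mathcal{F}_{\Lambda_-}$-measurable; (b) for each $B\in\mathcal{F}_{\Lambda_-}$ and $\omega\in\Omega$, $f_\Lambda(B\mid\omega)=\mathbf{1}_B(\omega)$; (c) for each $\Delta\in\mathcal{S}_b$ with $\Delta\supset\Lambda$, $f_\Delta f_\Lambda=f_\Delta$ on $\mathcal{F}_{\le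 m_\Lambda}$, i.e. $\int\!\int h(\xi)f_\Lambda(d\xi\mid\sigma)f_\Delta(d\sigma\mid\omega)=\int h(\sigma)f_\Delta(d\sigma\mid\omega)$ for each $\mathcal{F}_{\le m_\Lambda}$-measurable $h$ and each $\omega\in\Omega$. A probability measure $\mu$ on $(\Omega,\mathcal{F})$ is consistent with $f$ (a chain consistent with $f$) if $\mu f_\Lambda=\mu$ on $\mathcal{F}_{\le m_\Lambda}$ for every $\Lambda\in\mathcal{S}_b$, where $(\mu f_\Lambda)(A)=\int f_\Lambda(A\mid\omega)\mu(d\omega)$. $\mathcal{G}(f)$ denotes the set of all such measures. The shift acts on configurations by $\tau\omega=(\omega_{i-1})_{i\in\mathbb{Z}}$, and $\Omega$ is assumed shift-invariant ($\tau\Omega=\Omega$). On sets, $\tau A=\{\tau\omega:\omega\in A\}$; on functions, $(\tau h)(\omega)=h(\tau^{-1}\omega)$; on measures, $(\tau\mu)(h)=\mu(\tau^{-1}h)$. $\mathcal{I}$ is the $\sigma$-algebra of all $A\in\mathcal{F}$ with $\tau A=A$; $\mathcal{P}_{\mathrm{inv}}(\Omega,\mathcal{F})$ is the set of probability measures on $(\Omega,\mathcal{F})$ with $\tau\mu=\mu$. A measure in $\mathcal{P}_{\mathrm{inv}}(\Omega,\mathcal{F})$ is ergodic if it takes only the values $0$ and $1$ on $\mathcal{I}$. The LIS $f$ is shift-invariant if $f_{\Lambda+1}(\tau A\mid\tau\omega)=f_\Lambda(A\mid\omega)$ for each $\Lambda\in\mathcal{S}_b$, $A\in\mathcal{F}_{\le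 m_\Lambda}$ and $\omega\in\Omega$, where $\Lambda+1=\{i+1:i\in\Lambda\}$. $\mathcal{G}_{\mathrm{inv}}(f)=\mathcal{G}(f)\cap\mathcal{P}_{\mathrm{inv}}(\Omega,\mathcal{F})$. *)

(* Defs.v *)
From HB Require Import structures.
From mathcomp Require Import all_boot all_order all_algebra interval_inference.
From mathcomp Require Import all_classical all_reals all_analysis.
From mathcomp Require Import measurable_realfun giry.

Set Implicit Arguments.
Unset Strict Implicit.
Unset Printing Implicit Defensive.

Import Order.TTheory GRing.Theory Num.Theory.

Local Open Scope classical_set_scope.
Local Open Scope ring_scope.

Definition shiftZ (E : Type) (w : int -> E) : int -> E := fun i => w (i - 1).

(* Nonemptiness is only there because a measurableType is pointed: on an empty
   set of configurations there is no probability measure at all. *)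
Record admissible (E : Type) := Admissible {
  config_set :> set (int -> E) ;
  config_nonempty : config_set !=set0 ;
  config_shift : @shiftZ E @` config_set = config_set }.

Definition coord_sets d (E : measurableType d) (T : Type) (X : int -> T -> E)
    (L : set int) : set (set T) :=
  \bigcup_(i in L) preimage_set_system setT (X i) measurable.

Definition product_space d (E : measurableType d) :=
  g_sigma_algebraType (coord_sets (fun i (w : int -> E) => w i) setT).

Definition config (E : Type) (Omega : admissible E) : Type := set_type Omega.

Section configurations.
Context d (E : measurableType d) (Omega : admissible E).

Definition config_fun (w : config Omega) : product_space E := set_val w.

Let config_point : config Omega :=
  exist _ (sval (cid (config_nonempty Omega)))
    (mem_set (svalP (cid (config_nonempty Omega)))).

HB.instance Definition _ := Choice.on (config Omega).
HB.instance Definition _ := isPointed.Build (config Omega) config_point.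

(* F: the trace on Omega of the product sigma-algebra *)
HB.instance Definition _ := Measurable.copy (config Omega)
  (g_sigma_algebra_preimageType config_fun).

(* Omega equipped with F_L, the sigma-algebra of the coordinates in L *)
Definition configF (L : set int) :=
  g_sigma_algebraType (coord_sets (fun i (w : config Omega) => config_fun w i) L).

Lemma shift_subproof (w : config Omega) :
  shiftZ (config_fun w) \in (Omega : set (int -> E)).
Proof.
by rewrite inE -[X in X _]config_shift; exists (config_fun w) => //; exact: set_valP.
Qed.

Definition shift_config (w : config Omega) : config Omega :=
  exist _ (shiftZ (config_fun w)) (shift_subproof w).

End configurations.

Record fin_interval := FinInterval {
  imin : int ; imax : int ; imin_le_imax : imin <= imax }.

Definition interval_set (L : fin_interval) : set int :=
  [set i | imin L <= i <= imax L].

Definition upto (L : fin_interval) : set int := [set i | i <= imax L].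

Definition before (L : fin_interval) : set int := [set i | i <= imin L - 1].

Lemma shift_interval_subproof (L : fin_interval) : imin L + 1 <= imax L + 1.
Proof. by rewrite lerD2r; exact: imin_le_imax. Qed.

Definition shift_interval (L : fin_interval) : fin_interval :=
  FinInterval (shift_interval_subproof L).

Section mixture.
Context d (T : measurableType d) (R : realType).

Section mix.
Variables (s : {i01 R}) (mu nu : probability T R).

(* s * mu + (1 - s) * nu *)
Definition mix : set T -> \bar R :=
  measure_add (mscale (s%:num)%:nng mu) (mscale (1 - s%:num)%:nng nu).

HB.instance Definition _ := Measure.on mix.

Let mix_setT : mix setT = 1%E.
Proof.
rewrite /mix measure_addE/= /mscale/= !probability_setT !mule1 -EFinD.
by rewrite addrC subrK.
Qed.

HB.instance Definition _ := Measure_isProbability.Build _ _ _ mix mix_setT.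

End mix.

(* Measures are compared on measurable sets only: a MathComp-Analysis measure is
   a function on all sets, unconstrained on nonmeasurable ones. *)
Definition extreme_point (G : set (probability T R)) (mu : probability T R) :=
  G mu /\ forall (nu1 nu2 : probability T R) (s : {i01 R}),
    G nu1 -> G nu2 -> 0 < s%:num < 1 -> measure_eq (mix s nu1 nu2) mu ->
    measure_eq nu1 mu /\ measure_eq nu2 mu.

Definition is_face (P G : set (probability T R)) :=
  [/\ G `<=` P,
      forall (mu nu : probability T R) (s : {i01 R}),
        G mu -> G nu -> G (mix s mu nu) &
      forall (mu nu : probability T R) (s : {i01 R}),
        P mu -> P nu -> 0 < s%:num < 1 -> G (mix s mu nu) -> G mu /\ G nu].

End mixture.

Section lis.
Context d (E : measurableType d) (Omega : admissible E) (R : realType).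

Definition kernel_family :=
  forall L : fin_interval, R.-pker (config Omega) ~> (configF Omega (upto L)).

(* The last clause is stated for [0, +oo]-valued h, for which all integrals are
   meaningful; by linearity it gives every h integrable for f D w. *)
Definition is_lis (f : kernel_family) := forall L : fin_interval,
  [/\ forall A : set (configF Omega (upto L)), measurable A ->
        measurable_fun [set: configF Omega (before L)] (fun w => f L w A),
      forall B : set (configF Omega (before L)), measurable B ->
        forall w : config Omega, f L w B = (\1_B w)%:E &
      forall D : fin_interval, interval_set L `<=` interval_set D ->
        forall h : configF Omega (upto L) -> \bar R,
          measurable_fun setT h -> (forall w, 0 <= h w)%E ->
        forall w : config Omega,
          (\int[f D w]_v \int[f L v]_u h u = \int[f D w]_v h v)%E].

Definition lis_shift_invariant (f : kernel_family) :=
  forall (L : fin_interval) (A : set (configF Omega (upto L))), measurable A ->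
    forall w : config Omega,
      f (shift_interval L) (shift_config w) (@shift_config _ E Omega @` A) = f L w A.

Definition consistent (f : kernel_family) : set (probability (config Omega) R) :=
  [set mu | forall (L : fin_interval) (A : set (configF Omega (upto L))),
    measurable A -> (\int[mu]_w f L w A)%E = mu A].

Definition Pinv : set (probability (config Omega) R) :=
  [set mu | forall A : set (config Omega), measurable A ->
    pushforward mu (@shift_config _ E Omega) A = mu A].

Definition Ginv (f : kernel_family) := consistent f `&` Pinv.

Definition invariant_sets : set (set (config Omega)) :=
  [set A | measurable A /\ @shift_config _ E Omega @` A = A].

Definition ergodic : set (probability (config Omega) R) :=
  [set mu | Pinv mu /\
    forall A, invariant_sets A -> mu A = 0%E \/ mu A = 1%E].

End lis.

(* Main.v *)
Require Import Defs.
From mathcomp Require Import all_boot all_order all_algebra interval_inference.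
From mathcomp Require Import all_classical all_reals all_analysis.
From mathcomp Require Import measurable_realfun giry.
From mathcomp Require Import ring lra zify.

(** Everything rests on stability under domination ([Ginv_dominated]): an
    invariant measure [nu] that is absolutely continuous with respect to an
    invariant consistent [mu] is itself consistent. Fix an interval [L] and an
    event [A] of the past up to the right end of [L]. The function
    [phi w = f L w A - \1_A w] (the [innovation]) is bounded by 1, and
    consistency of a measure for [L] and [A] says exactly that [phi] has
    integral 0 ([innovation_integral]). As [f L w] is deterministic on the past of [L],
    consistency of [mu] gives more: [phi] is orthogonal in L2(mu) to every
    bounded function of that past ([innovation_orthogonal]). Let [theta] be
    the shift iterated as many times as [L] has points. Then the composites of
    [phi] with the positive iterates of [theta] depend on the past of [L]
    only, so, [mu] being invariant, the functions [phi \o iter i theta] are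
    pairwise orthogonal and their sum over [i < n] has squared L2(mu)-norm at
    most [n] ([birkhoff_sum_sqr]). Hence the Birkhoff averages of [phi] tend
    to 0 in [mu]-probability, and by absolute continuity also in
    [nu]-probability. They are bounded and, [nu] being invariant, all have the
    [nu]-integral of [phi], which is therefore 0 ([orthogonal_dominated_eq0]).

    The face property follows, because each component of a nontrivial mixture
    is absolutely continuous with respect to the mixture.

    As to extreme points, if an invariant set [A] has measure strictly between
    0 and 1, then the two conditional measures on [A] and on its complement
    belong to [Ginv f] by domination, and [mu] is a nontrivial mixture of
    them, so it is not extreme. Conversely, an ergodic [mu] is the only
    invariant probability [nu << mu] ([ergodic_dominated_eq]). The sets on
    which [nu - mu] attains its maximum, provided by a Hahn decomposition, are
    stable under preimage by the shift and under countable unions and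
    intersections, so one of them is strictly invariant. Its [mu]-measure is 0
    or 1 and [nu] gives it the same value, so the maximum of [nu - mu] is 0;
    as both have total mass 1, they are equal. *)

Set Implicit Arguments.
Unset Strict Implicit.
Unset Printing Implicit Defensive.

Import Order.TTheory GRing.Theory Num.Theory.

Local Open Scope classical_set_scope.
Local Open Scope ring_scope.

(** * Birkhoff sums of a measure-preserving map *)

Lemma bounded_integrable d (T : measurableType d) (R : realType)
    (mu : probability T R) (f : T -> R) (M : R) :
  measurable_fun setT f -> (forall x, `|f x| <= M) ->
  mu.-integrable setT (EFin \o f).
Proof.
move=> mf fM; apply: measurable_bounded_integrable => //.
  by rewrite (le_lt_trans (probability_le1 mu measurableT))// ltry.
by exists M; split => [|y My x _];
  [exact: num_real|exact: le_trans (fM x) (ltW My)].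
Qed.

Lemma Rintegral_cst_probability d (T : measurableType d) (R : realType)
    (mu : probability T R) (k : R) : \int[mu]_x k = k.
Proof.
by rewrite Rintegral_cst//= probability_setT mulr1.
Qed.

Section measure_preserving.
Context d (T : measurableType d) (R : realType) (theta : T -> T).

Definition preserves (mu : probability T R) :=
  forall A, measurable A -> mu (theta @^-1` A) = mu A.

Lemma measurable_iter n :
  measurable_fun setT theta -> measurable_fun setT (iter n theta).
Proof.
move=> mt; elim: n => [|n IH]; first exact: measurable_id.
exact: (measurableT_comp mt IH).
Qed.

Lemma preserves_iter (mu : probability T R) n : measurable_fun setT theta ->
  preserves mu -> forall A, measurable A -> mu (iter n theta @^-1` A) = mu A.
Proof.
move=> mt inv; elim: n => [//|n IH] A mA.
have mpre : measurable (theta @^-1` A).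
  by rewrite -[X in measurable X]setTI; exact: mt.
by rewrite -[RHS]inv// -(IH _ mpre).
Qed.

Definition birkhoff_sum (phi : T -> R) n x := \sum_(i < n) phi (iter i theta x).

Lemma birkhoff_sum0 phi x : birkhoff_sum phi 0 x = 0.
Proof. by rewrite /birkhoff_sum big_ord0. Qed.

Lemma birkhoff_sumS phi n x :
  birkhoff_sum phi n.+1 x = phi x + birkhoff_sum phi n (theta x).
Proof.
rewrite /birkhoff_sum big_ord_recl; congr (_ + _).
by apply: eq_bigr => i _; rewrite -iterSr.
Qed.

Lemma birkhoff_sum_le phi n x :
  (forall x, `|phi x| <= 1) -> `|birkhoff_sum phi n x| <= n%:R.
Proof.
move=> phi1; apply: (le_trans (ler_norm_sum _ _ _)).
rewrite (le_trans (ler_sum _ (fun i _ => phi1 _)))//.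
by rewrite sumr_const card_ord.
Qed.

Hypothesis mtheta : measurable_fun setT theta.

Lemma measurable_birkhoff_sum phi n :
  measurable_fun setT phi -> measurable_fun setT (birkhoff_sum phi n).
Proof.
move=> mphi; elim: n => [|n IH].
  rewrite (_ : birkhoff_sum _ _ = cst 0)//.
  by apply/funext => x; rewrite birkhoff_sum0.
rewrite (_ : birkhoff_sum _ _ = phi \+ (birkhoff_sum phi n \o theta)); last first.
  by apply/funext => x; rewrite birkhoff_sumS.
by apply: measurable_funD => //; exact: measurableT_comp.
Qed.

Lemma Rintegral_preserves (mu : probability T R) (g : T -> R) (M : R) :
  preserves mu -> measurable_fun setT g -> (forall x, `|g x| <= M) ->
  \int[mu]_x g (theta x) = \int[mu]_x g x.
Proof.
move=> inv mg gM; rewrite /Rintegral; congr fine.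
rewrite [RHS](@eq_measure_integral _ _ _ setT (pushforward mu theta) mu); last first.
  by move=> A mA _; rewrite -[LHS]inv.
rewrite [RHS](@integral_pushforward _ _ _ _ _ _ mtheta mu setT)//.
- exact/measurable_EFinP.
- rewrite preimage_setT.
  apply: (@bounded_integrable _ _ _ _ (g \o theta) M) => [|x]; last exact: gM.
  exact: measurableT_comp.
Qed.

(** Removing the first term of the sum leaves a Birkhoff sum composed with
    [theta]. The orthogonality hypothesis cancels the cross term of the square
    and invariance turns the remaining square into the one for [n], so the
    second moment grows by at most the integral of [phi ^+ 2], that is by at
    most 1. *)
Lemma birkhoff_sum_sqr (mu : probability T R) (phi : T -> R) :
  preserves mu -> measurable_fun setT phi -> (forall x, `|phi x| <= 1) ->
  (forall n, \int[mu]_x (phi x * birkhoff_sum phi n (theta x)) = 0) ->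
  forall n, \int[mu]_x (birkhoff_sum phi n x ^+ 2) <= n%:R.
Proof.
move=> inv mphi phi1 orth; elim => [|n IH].
  under eq_Rintegral do rewrite birkhoff_sum0 expr0n/=.
  by rewrite Rintegral_cst// mul0r.
have mS := measurable_birkhoff_sum n mphi.
have mSt : measurable_fun setT (birkhoff_sum phi n \o theta).
  exact: measurableT_comp.
have Sn x := birkhoff_sum_le n x phi1.
have i1 : mu.-integrable setT (EFin \o (fun x => phi x ^+ 2)).
  apply: (@bounded_integrable _ _ _ _ _ 1); first exact: measurable_funX.
  by move=> x; rewrite normrX expr_le1.
have i2 : mu.-integrable setT
    (EFin \o (fun x => (phi x * birkhoff_sum phi n (theta x)) * 2)).
  apply: (@bounded_integrable _ _ _ _ _ (n%:R * 2)).
    by apply: measurable_funM => //; exact: measurable_funM.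
  move=> x; rewrite !normrM [`|2|]ger0_norm// ler_pM2r//.
  by rewrite -[leRHS]mul1r ler_pM.
have i2' : mu.-integrable setT
    (EFin \o (fun x => (phi x * birkhoff_sum phi n (theta x)))).
  apply: (@bounded_integrable _ _ _ _ _ n%:R); first exact: measurable_funM.
  by move=> x; rewrite normrM -[leRHS]mul1r ler_pM.
have i3 : mu.-integrable setT (EFin \o (fun x => birkhoff_sum phi n (theta x) ^+ 2)).
  apply: (@bounded_integrable _ _ _ _ _ (n%:R ^+ 2)).
    exact: (measurable_funX 2%N mSt).
  by move=> x; rewrite normrX lerXn2r// nnegrE.
have i23 : mu.-integrable setT (EFin \o (fun x =>
  (phi x * birkhoff_sum phi n (theta x)) * 2 + birkhoff_sum phi n (theta x) ^+ 2)).
  exact: (@integrableD _ _ _ mu setT measurableT _ _ i2 i3).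
have -> : \int[mu]_x (birkhoff_sum phi n.+1 x ^+ 2) =
  \int[mu]_x (phi x ^+ 2 + ((phi x * birkhoff_sum phi n (theta x)) * 2 +
      birkhoff_sum phi n (theta x) ^+ 2)).
  by apply: eq_Rintegral => x _; rewrite birkhoff_sumS; ring.
rewrite RintegralD// RintegralD// RintegralZr// orth mul0r add0r.
rewrite (@Rintegral_preserves mu (fun x => birkhoff_sum phi n x ^+ 2) (n%:R ^+ 2))//.
- rewrite -nat1r lerD//.
  have -> : 1 = \int[mu]_(x in setT) (1:R).
    by rewrite Rintegral_cst_probability.
  apply: le_Rintegral => //.
    by apply: finite_measure_integrable_cst.
  by move=> x _; rewrite (le_trans (ler_norm _))// normrX expr_le1.
- exact: measurable_funX.
- by move=> x; rewrite normrX lerXn2r// nnegrE.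
Qed.

Lemma Rintegral_birkhoff_sum (nu : probability T R) (phi : T -> R) n :
  preserves nu -> measurable_fun setT phi -> (forall x, `|phi x| <= 1) ->
  \int[nu]_x birkhoff_sum phi n x = n%:R * \int[nu]_x phi x.
Proof.
move=> inv mphi phi1; elim: n => [|n IH].
  by under eq_Rintegral do rewrite birkhoff_sum0; rewrite Rintegral_cst// !mul0r.
have mS := measurable_birkhoff_sum n mphi.
have Sn x := birkhoff_sum_le n x phi1.
under eq_Rintegral do rewrite birkhoff_sumS.
rewrite RintegralD//.
- by rewrite (Rintegral_preserves inv mS Sn) IH -nat1r mulrDl mul1r.
- exact: bounded_integrable phi1.
- apply: (@bounded_integrable _ _ _ _ (birkhoff_sum phi n \o theta) n%:R) => [|x];
    last exact: Sn.
  exact: measurableT_comp.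
Qed.

End measure_preserving.

(** The total variation of the charge of a finite measure bounds the measure, so
    the epsilon-delta form of absolute continuity for charges applies to it. *)
Lemma dominates_small d (T : measurableType d) (R : realType)
    (mu nu : probability T R) : nu `<< mu -> forall e : R, 0 < e ->
  exists delta : R, 0 < delta /\
    forall A, measurable A -> (mu A < delta%:E)%E -> (nu A < e%:E)%E.
Proof.
move=> numu e e0.
have [P [N PN]] := Hahn_decomposition (charge_of_finite_measure nu).
have [delta [d0 H]] := charge_variation_continuous PN numu e0.
exists delta; split => // A mA /(H A mA); apply: le_lt_trans.
by rewrite -(gee0_abs (measure_ge0 nu A)) (abse_charge_variation PN).
Qed.

(** Chebyshev's inequality under [mu], transferred to [nu]: for large [n], the
    Birkhoff sum exceeds [e / 2 * n] only on a set of [mu]-measure so small that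
    its [nu]-measure is below [e / 2]. On that set the sum is still at most [n],
    so the [nu]-integral of the sum, which is [n] times that of [phi], is at
    most [e * n] in absolute value. *)
Lemma orthogonal_dominated_eq0 d (T : measurableType d) (R : realType)
    (theta : T -> T) (mu nu : probability T R) (phi : T -> R) :
  measurable_fun setT theta -> preserves theta mu -> preserves theta nu ->
  nu `<< mu -> measurable_fun setT phi -> (forall x, `|phi x| <= 1) ->
  (forall n, \int[mu]_x (phi x * birkhoff_sum theta phi n (theta x)) = 0) ->
  \int[nu]_x phi x = 0.
Proof.
move=> mt muinv nuinv numu mphi phi1 orth.
apply/eqP; rewrite -normr_le0; apply/ler_addgt0Pr => e e0; rewrite add0r.
have e20 : 0 < e / 2 by rewrite divr_gt0.
have [delta [d0 H]] := dominates_small numu e20.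
(* Chebyshev bounds the measure of the exceptional set by 1 / ((e / 2)^2 n),
   which this n makes smaller than delta. *)
pose n := (Num.truncn (((e / 2) ^+ 2 * delta)^-1)).+1.
have n0 : 0 < n%:R :> R by rewrite ltr0n.
have nd : ((e / 2) ^+ 2 * delta)^-1 < n%:R by exact: truncnS_gt.
pose S := birkhoff_sum theta phi n.
have mS : measurable_fun setT S by exact: measurable_birkhoff_sum.
have Sn x : `|S x| <= n%:R by exact: birkhoff_sum_le.
pose c : R := e / 2 * n%:R.
have c0 : 0 < c by rewrite mulr_gt0.
pose B := [set x | c <= `|S x|].
have mB : measurable B.
  rewrite -[B]setTI; apply: (measurable_fun_ler (f := cst c)) => //.
  exact: measurableT_comp.
have iB (m : probability T R) k :
    m.-integrable setT (EFin \o (fun x => \1_B x * k)).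
  apply: (@bounded_integrable _ _ _ _ _ `|k|); first exact: measurable_funM.
  move=> x; rewrite normrM indicE; case: (_ \in _) => /=.
    by rewrite normr1 mul1r.
  by rewrite normr0 mul0r.
have IB (m : probability T R) k : \int[m]_x (\1_B x * k) = fine (m B) * k.
  rewrite RintegralZr//; last first.
    by have := iB m 1; under eq_fun do rewrite mulr1.
  by rewrite /Rintegral integral_indic// setIT.
have nuB : (nu B < (e / 2)%:E)%E.
  apply: H => //.
  have : fine (mu B) * c ^+ 2 <= n%:R.
    rewrite -IB; apply: le_trans (birkhoff_sum_sqr mt muinv mphi phi1 orth n).
    apply: le_Rintegral => //; first exact: (iB mu (c ^+ 2)).
      apply: (@bounded_integrable _ _ _ _ _ (n%:R ^+ 2)).
        exact: measurable_funX.
      by move=> x; rewrite normrX lerXn2r// nnegrE.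
    move=> x _; rewrite indicE; case: (boolP (x \in B)) => xB /=; last first.
      by rewrite mul0r sqr_ge0.
    rewrite mul1r -[leRHS]real_normK ?num_real// lerXn2r ?nnegrE//; first exact: ltW.
    by move: xB; rewrite inE.
  move=> h; rewrite -(@fineK _ (mu B)) ?fin_num_measure// lte_fin.
  rewrite -(ltr_pM2r (exprn_gt0 2 c0)); apply: (le_lt_trans h).
  have : 1 < (e / 2) ^+ 2 * delta * n%:R.
    by rewrite mulrC -ltr_pdivrMr ?div1r// mulr_gt0// exprn_gt0.
  rewrite /c => h1.
  have -> : delta * (e / 2 * n%:R) ^+ 2 =
      n%:R * ((e / 2) ^+ 2 * delta * n%:R) by ring.
  by rewrite -[ltLHS]mulr1 ltr_pM2l.
(* |S| <= c off B and |S| <= n on B. *)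
have : `|n%:R * \int[nu]_x phi x| <= c + fine (nu B) * n%:R.
  rewrite -(Rintegral_birkhoff_sum mt n nuinv mphi phi1).
  have -> : c = \int[nu]_(x in setT) c by rewrite Rintegral_cst_probability.
  have iS : nu.-integrable setT (EFin \o S) by exact: bounded_integrable Sn.
  have ic := @finite_measure_integrable_cst _ _ _ nu setT c measurableT.
  rewrite -IB -RintegralD//; last exact: iB.
  apply: (le_trans (le_normr_Rintegral measurableT iS)).
  apply: le_Rintegral => //.
  - exact: integrable_norm.
  - exact: (@integrableD _ _ _ nu setT measurableT _ _ ic (iB nu n%:R)).
  - move=> x _; rewrite indicE; case: (boolP (x \in B)) => xB /=.
      by rewrite mul1r (le_trans (Sn x))// lerDr ltW.
    rewrite mul0r addr0; move: xB; rewrite notin_setE /B/= => /negP.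
    by rewrite -ltNge => /ltW.
rewrite normrM ger0_norm// /c -mulrDl [leRHS]mulrC ler_pM2l//.
move=> /le_trans; apply.
have : fine (nu B) <= e / 2.
  by rewrite -lee_fin fineK ?fin_num_measure// ltW.
by lra.
Qed.

(** * Integrals against functions of a sub-sigma-algebra *)

(** A sub-sigma-algebra of the one of [T] is represented by a second measurable
    type [T'] and a measurable map [p], which is the identity of the common
    carrier in the intended use. *)
Section test_functions.
Import HBNNSimple.

Context d d' (T : measurableType d) (T' : measurableType d') (R : realType)
  (mu : {measure set T -> \bar R}) (p : T -> T') (mp : measurable_fun setT p).

(** The right-hand side sees [h] only through its integrals over sets of the
    sub-sigma-algebra. *)
Lemma integral_weight_lim (h : T -> R) (mh : measurable_fun setT h)
    (h0 : forall x, 0 <= h x) (g : T' -> R)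
    (mg : measurable_fun setT (EFin \o g)) (g0 : forall x, 0 <= g x) :
  let gn := nnsfun_approx measurableT mg in
  (\int[mu]_x (g (p x) * h x)%:E =
   limn (fun n => \sum_(r \in range (gn n))
     r%:E * \int[mu]_x (\1_(gn n @^-1` [set r]) (p x) * h x)%:E))%E.
Proof.
move=> gn.
have mgn n : measurable_fun setT (fun x => gn n (p x) * h x).
  by apply: measurable_funM => //; exact: measurableT_comp.
transitivity (limn (fun n => \int[mu]_x (gn n (p x) * h x)%:E)%E).
  rewrite -monotone_convergence//.
  - apply: eq_integral => x _; apply/esym/cvg_lim => //.
    under eq_fun do rewrite EFinM.
    rewrite EFinM; apply: cvgeZr => //.
    by apply: (@cvg_nnsfun_approx _ _ _ _ measurableT _ mg) => // y _; rewrite lee_fin.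
  - by move=> n; exact/measurable_EFinP.
  - by move=> n x _; rewrite lee_fin mulr_ge0.
  - move=> x _ m n mn; rewrite lee_fin ler_wpM2r//.
    exact/lefP/nd_nnsfun_approx.
congr (limn _); apply/funext => n.
transitivity (\int[mu]_x (\sum_(r \in range (gn n))
    (r * (\1_(gn n @^-1` [set r]) (p x) * h x))%:E))%E.
  apply: eq_integral => x _; rewrite fimfunE fsumEFin//; congr EFin.
  by rewrite mulrC mulr_fsumr; apply: eq_fsbigr => r _; ring.
rewrite ge0_integral_fsum//; last 2 first.
- move=> r; apply/measurable_EFinP; do 2 apply: measurable_funM => //.
  by apply: measurableT_comp => //; exact: measurable_indic.
- move=> r x _; rewrite mulrA EFinM mule_ge0 ?lee_fin//.
  exact: nnfun_muleindic_ge0.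
apply: eq_fsbigr => r /[!inE] -[y _ <-].
under eq_integral do rewrite EFinM.
rewrite ge0_integralZl//.
- apply/measurable_EFinP; apply: measurable_funM => //.
  by apply: measurableT_comp => //; exact: measurable_indic.
- by move=> x _; rewrite lee_fin mulr_ge0.
- by rewrite lee_fin.
Qed.

Lemma integral_weight_eq (h1 h2 : T -> R) (mh1 : measurable_fun setT h1)
    (mh2 : measurable_fun setT h2)
    (h10 : forall x, 0 <= h1 x) (h20 : forall x, 0 <= h2 x) :
  (forall B, measurable B -> \int[mu]_x (\1_B (p x) * h1 x)%:E =
    \int[mu]_x (\1_B (p x) * h2 x)%:E)%E ->
  forall g : T' -> R, measurable_fun setT g -> (forall y, 0 <= g y) ->
  (\int[mu]_x (g (p x) * h1 x)%:E = \int[mu]_x (g (p x) * h2 x)%:E)%E.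
Proof.
move=> H g mg g0; have mg' := (measurable_EFinP _ _).2 mg.
rewrite (integral_weight_lim mh1 h10 mg' g0) (integral_weight_lim mh2 h20 mg' g0).
by congr (limn _); apply/funext => n; apply: eq_fsbigr => r _; rewrite H.
Qed.

End test_functions.

(** * Measurability of the shift *)

Section shift_measurability.
Context d (E : measurableType d) (Omega : admissible E).

Lemma measurable_coord (L : set int) (i : int) : L i ->
  measurable_fun [set: configF Omega L] (fun w => config_fun w i : E).
Proof.
by move=> Li _ Y mY; apply: sub_sigma_algebra; exists i => //; exists Y.
Qed.

Lemma measurable_coord_config (i : int) :
  measurable_fun [set: config Omega] (fun w => config_fun w i : E).
Proof.
move=> _ Y mY.
exists ((fun w : int -> E => w i) @^-1` Y); last by rewrite !setTI.
by apply: sub_sigma_algebra; exists i => //; exists Y => //; rewrite setTI.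
Qed.

Lemma measurable_to_configF d' (T : measurableType d') (L : set int)
    (h : T -> config Omega) :
  (forall i, L i -> measurable_fun setT (fun x => config_fun (h x) i : E)) ->
  measurable_fun setT (h : T -> configF Omega L).
Proof.
move=> H; apply: (@measurability _ _ _ (configF Omega L) _ _ (coord_sets
  (fun i (w : config Omega) => config_fun w i : E) L)) => //.
move=> _ [_ [i Li [Y mY <-] <-]]; rewrite !setTI.
by have := H i Li measurableT Y mY; rewrite setTI.
Qed.

Lemma measurable_to_config d' (T : measurableType d') (h : T -> config Omega) :
  (forall i, measurable_fun setT (fun x => config_fun (h x) i : E)) ->
  measurable_fun setT h.
Proof.
move=> H _ _ [Y mY <-]; rewrite !setTI.
have mh : measurable_fun setT (@config_fun _ E Omega \o h).
  apply: (@measurability _ _ _ (product_space E) _ _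
    (coord_sets (fun i (w : int -> E) => w i) setT)) => //.
  move=> _ [_ [i Li [Z mZ <-] <-]]; rewrite !setTI.
  by have := H i measurableT Z mZ; rewrite setTI.
by have := mh measurableT Y mY; rewrite setTI.
Qed.

Lemma measurable_forget (L : set int) :
  measurable_fun [set: config Omega] (id : config Omega -> configF Omega L).
Proof. by apply: measurable_to_configF => i _; exact: measurable_coord_config. Qed.

Lemma measurable_coarsen (L L' : set int) : L `<=` L' ->
  measurable_fun [set: configF Omega L'] (id : config Omega -> configF Omega L).
Proof.
by move=> LL; apply: measurable_to_configF => i /LL; exact: measurable_coord.
Qed.

Lemma measurable_configF (L : set int) (A : set (configF Omega L)) :
  measurable A -> measurable (A : set (config Omega)).
Proof. by move=> mA; have := measurable_forget measurableT mA; rewrite setTI. Qed.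

Lemma measurable_configF_subset (L L' : set int) (A : set (configF Omega L)) :
  L `<=` L' -> measurable A -> measurable (A : set (configF Omega L')).
Proof.
by move=> LL mA; have := measurable_coarsen LL measurableT mA; rewrite setTI.
Qed.

Lemma config_fun_iter_shift n (w : config Omega) i :
  config_fun (iter n (@shift_config _ E Omega) w) i = config_fun w (i - n%:Z).
Proof.
elim: n i => [|n IH] i; first by rewrite subr0.
rewrite iterS.
transitivity (config_fun (iter n (@shift_config _ E Omega) w) (i - 1)); first by [].
rewrite IH.
by congr (config_fun w _); rewrite intS opprD addrA.
Qed.

Lemma measurable_shift : measurable_fun setT (@shift_config _ E Omega).
Proof. by apply: measurable_to_config => i; exact: measurable_coord_config. Qed.

(** The shift moves information into the past: coordinate [i] of the shifted
    configuration is coordinate [i - n] of the original one. *)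
Lemma measurable_iter_shift n (L L' : set int) :
  (forall i, L i -> L' (i - n%:Z)) ->
  measurable_fun [set: configF Omega L']
    (iter n (@shift_config _ E Omega) : _ -> configF Omega L).
Proof.
move=> LL; apply: measurable_to_configF => i /LL Li.
have := measurable_coord Li.
congr (measurable_fun _ _); apply/funext => w.
exact/esym/config_fun_iter_shift.
Qed.

End shift_measurability.

(** * Consistency and domination *)

Section consistency.
Context d (E : measurableType d) (Omega : admissible E) (R : realType)
  (f : kernel_family Omega R) (f_lis : is_lis f).

Lemma upto_before (L : fin_interval) : before L `<=` upto L.
Proof.
move=> i; rewrite /before /upto /= => h; apply: (le_trans h).
by have := imin_le_imax L; lia.
Qed.

(** [f L w] gives [B] measure 0 or 1 according to [w], so intersecting with [B]
    either changes nothing or leaves a null set. *)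
Lemma kernel_restr (L : fin_interval) (A : set (configF Omega (upto L)))
    (B : set (configF Omega (before L))) (w : config Omega) :
  measurable A -> measurable B ->
  (f L w (A `&` B) = (\1_B w)%:E * f L w A)%E.
Proof.
move=> mA mB.
have mB' : measurable (B : set (configF Omega (upto L))).
  exact: measurable_configF_subset (@upto_before L) mB.
have [_ fD _] := f_lis L.
have fB := fD _ mB w; have fBC := fD _ (measurableC mB) w.
have [wB|wB] := pselect (B w).
  rewrite indicE mem_set// mul1e.
  have : f L w (A `\` B) = 0%E.
    apply: (@subset_measure0 _ _ _ (f L w) _ (~` B)) => //.
    - exact: measurableD.
    - exact: measurableC.
    - by apply: (etrans fBC); rewrite indicE memNset.
  move=> h; rewrite -[in RHS](setUIDK A B) measureU//.
  - by rewrite [X in (_ + X)%E]h adde0.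
  - exact: measurableI.
  - exact: measurableD.
  - by rewrite setDE setIACA setICr setI0.
rewrite indicE memNset// mul0e.
apply: (@subset_measure0 _ _ _ (f L w) _ B) => //; first exact: measurableI.
by apply: (etrans fB); rewrite indicE memNset.
Qed.

Section one_interval.
Variables (L : fin_interval) (A : set (configF Omega (upto L))).
Hypothesis mA : measurable A.

Definition kernel_val (w : config Omega) : R := fine (f L w A).

Definition innovation (w : config Omega) : R := kernel_val w - \1_A w.

Lemma kernel_le1 w : (f L w A <= 1)%E.
Proof.
have <- : f L w setT = 1%E by exact: prob_kernel.
by apply: le_measure; rewrite ?inE.
Qed.

Lemma kernel_valE w : (kernel_val w)%:E = f L w A.
Proof. by rewrite fineK// ge0_fin_numE// (le_lt_trans (kernel_le1 w))// ltry. Qed.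

Lemma kernel_val_ge0 w : 0 <= kernel_val w.
Proof. by rewrite fine_ge0. Qed.

Lemma kernel_val_le1 w : kernel_val w <= 1.
Proof. by rewrite -lee_fin kernel_valE kernel_le1. Qed.

Lemma innovation_le1 w : `|innovation w| <= 1.
Proof.
rewrite /innovation indicE.
by have := kernel_val_ge0 w; have := kernel_val_le1 w; case: (_ \in _) => /=;
   rewrite ler_norml; lra.
Qed.

Lemma measurable_kernel_val :
  measurable_fun [set: configF Omega (before L)] kernel_val.
Proof.
have [/(_ A mA) h _ _] := f_lis L.
exact: (measurableT_comp _ h).
Qed.

Lemma measurable_innovation :
  measurable_fun [set: configF Omega (upto L)] innovation.
Proof.
apply: measurable_funB; last exact: measurable_indic.
exact: (measurableT_comp measurable_kernel_val
  (measurable_coarsen (@upto_before L))).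
Qed.

Lemma measurable_innovation_config : measurable_fun setT innovation.
Proof.
exact: (measurableT_comp measurable_innovation
  (@measurable_forget _ E Omega (upto L))).
Qed.

(** This turns consistency into the vanishing of the integral of a function
    bounded by 1, the form to which [orthogonal_dominated_eq0] applies. *)
Lemma innovation_integral (nu : probability (config Omega) R) :
  \int[nu]_w innovation w = 0 <-> (\int[nu]_w f L w A)%E = nu A.
Proof.
have mAc : measurable (A : set (config Omega)) by exact: measurable_configF mA.
have mk : measurable_fun setT kernel_val.
  exact: (measurableT_comp measurable_kernel_val
    (@measurable_forget _ E Omega (before L))).
have ik : nu.-integrable setT (EFin \o kernel_val).
  apply: (bounded_integrable nu (M := 1) mk) => w.
  by rewrite ger0_norm ?kernel_val_ge0 ?kernel_val_le1.
rewrite RintegralB//; last exact: integrable_indic.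
rewrite [X in _ - X](_ : _ = fine (nu A)); last first.
  by rewrite /Rintegral integral_indic// setIT.
have -> : (\int[nu]_w f L w A)%E = (\int[nu]_w kernel_val w)%:E.
  rewrite /Rintegral fineK; last exact: integrable_fin_num.
  by apply: eq_integral => w _; rewrite kernel_valE.
rewrite -[X in _ <-> _ = X](@fineK _ (nu A)) ?fin_num_measure//.
by split => [/eqP|[->]]; rewrite ?subrr// subr_eq0 => /eqP ->.
Qed.

Variable mu : probability (config Omega) R.
Hypothesis cmu : consistent f mu.

(** For the indicator of [B], the claim is consistency at the event [A `&` B],
    by [kernel_restr]; [integral_weight_eq] extends it to functions. *)
Lemma innovation_orthogonal_ge0 (g : configF Omega (before L) -> R) (M : R) :
  measurable_fun setT g -> (forall w, 0 <= g w <= M) ->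
  \int[mu]_w (innovation w * g w) = 0.
Proof.
move=> mg gM.
have mAc : measurable (A : set (config Omega)) by exact: measurable_configF mA.
have mgc : measurable_fun setT (g : config Omega -> R).
  exact: (measurableT_comp mg (@measurable_forget _ E Omega (before L))).
have mk : measurable_fun setT kernel_val.
  exact: (measurableT_comp measurable_kernel_val
    (@measurable_forget _ E Omega (before L))).
have ik : mu.-integrable setT (EFin \o (fun w => g w * kernel_val w)).
  apply: (bounded_integrable _ (M := M)); first exact: measurable_funM.
  move=> w; have /andP[g0 g1] := gM w.
  rewrite ger0_norm ?mulr_ge0 ?kernel_val_ge0// -[leRHS]mulr1.
  by rewrite ler_pM ?kernel_val_ge0 ?kernel_val_le1.
have iA : mu.-integrable setT (EFin \o (fun w => g w * \1_A w)).
  apply: (bounded_integrable _ (M := M)); first exact: measurable_funM.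
  move=> w; have /andP[g0 g1] := gM w.
  rewrite indicE ger0_norm ?mulr_ge0//.
  by case: (_ \in _); rewrite ?mulr1 ?mulr0// (le_trans g0).
have -> : \int[mu]_w (innovation w * g w) =
    \int[mu]_w (g w * kernel_val w - g w * \1_A w).
  by apply: eq_Rintegral => w _; rewrite /innovation; ring.
rewrite RintegralB//; apply/eqP; rewrite subr_eq0; apply/eqP; congr fine.
apply: (@integral_weight_eq _ _ (config Omega) (configF Omega (before L)) R mu
  id (@measurable_forget _ E Omega (before L)) kernel_val \1_A _ _ _ _ _ g) => //.
- exact: kernel_val_ge0.
- move=> B mB.
  have mBu : measurable (B : set (configF Omega (upto L))).
    exact: measurable_configF_subset (@upto_before L) mB.
  have mBc : measurable (B : set (config Omega)) by exact: measurable_configF mB.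
  transitivity (mu (A `&` B)).
    rewrite -(cmu (L := L)); last exact: measurableI.
    by apply: eq_integral => w _; rewrite kernel_restr// -kernel_valE EFinM.
  have mAB : measurable (A `&` B : set (config Omega)) by exact: measurableI.
  have <- : (\int[mu]_w (\1_(A `&` B : set (config Omega)) w)%:E)%E = mu (A `&` B).
    by rewrite integral_indic// setIT.
  by apply: eq_integral => w _; rewrite indicI mulrC.
- by move=> w; have /andP[] := gM w.
Qed.

Lemma innovation_orthogonal (g : configF Omega (before L) -> R) (M : R) :
  measurable_fun setT g -> (forall w, `|g w| <= M) ->
  \int[mu]_w (innovation w * g w) = 0.
Proof.
move=> mg gM.
have mgc : measurable_fun setT (g : config Omega -> R).
  exact: (measurableT_comp mg (@measurable_forget _ E Omega (before L))).
have mi := measurable_innovation_config.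
have M0 : 0 <= M by exact: le_trans (normr_ge0 _) (gM point).
have i1 : mu.-integrable setT (EFin \o (fun w => innovation w * (g w + M))).
  apply: (bounded_integrable _ (M := M + M)).
    by apply: measurable_funM => //; exact: measurable_funD.
  move=> w; rewrite normrM -[leRHS]mul1r ler_pM ?innovation_le1//.
  by have := gM w; rewrite !ler_norml; lra.
have i2 : mu.-integrable setT (EFin \o (fun w => innovation w * M)).
  apply: (bounded_integrable _ (M := M)); first exact: measurable_funM.
  move=> w; rewrite normrM -[leRHS]mul1r ler_pM ?innovation_le1//.
  by rewrite ger0_norm ?M0.
(* Adding the constant M makes g nonnegative. *)
have -> : \int[mu]_w (innovation w * g w) =
    \int[mu]_w (innovation w * (g w + M) - innovation w * M).
  by apply: eq_Rintegral => w _; ring.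
rewrite RintegralB// (innovation_orthogonal_ge0 (g := fun w => g w + M) (M := M + M)).
- rewrite (innovation_orthogonal_ge0 (g := cst M) (M := M)) ?subrr// => w.
  by rewrite lexx M0.
- exact: measurable_funD.
- by move=> w; have := gM w; rewrite ler_norml; lra.
Qed.

End one_interval.

Lemma Pinv_preserves_iter (nu : probability (config Omega) R) n :
  Pinv nu -> preserves (iter n (@shift_config _ E Omega)) nu.
Proof.
move=> inu A mA; apply: preserves_iter => //; exact: measurable_shift.
Qed.

(** [N] is the number of points of [L], so that every coordinate up to the right
    end of [L] is moved by [theta] into the past of [L]: the Birkhoff sums of the
    innovation composed with [theta] are functions of that past, hence orthogonal
    to the innovation. *)
Lemma Ginv_dominated (mu nu : probability (config Omega) R) :
  Ginv f mu -> Pinv nu -> nu `<< mu -> Ginv f nu.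
Proof.
move=> [cmu imu] inu numu; split => // L A mA; apply/innovation_integral => //.
have LN := imin_le_imax L.
pose N := absz (imax L - imin L + 1).
pose theta := iter N (@shift_config _ E Omega).
have mtheta : measurable_fun setT theta.
  exact/measurable_iter/measurable_shift.
have mu_upto : measurable_fun [set: configF Omega (upto L)]
    (theta : _ -> configF Omega (upto L)).
  by apply: measurable_iter_shift => i; rewrite /upto/= /N; lia.
have mu_before : measurable_fun [set: configF Omega (before L)]
    (theta : _ -> configF Omega (upto L)).
  by apply: measurable_iter_shift => i; rewrite /upto /before/= /N; lia.
apply: (orthogonal_dominated_eq0 (theta := theta) (mu := mu)) => //.
- exact: Pinv_preserves_iter.
- exact: Pinv_preserves_iter.
- exact: measurable_innovation_config.
- exact: innovation_le1.
- move=> n; apply: (innovation_orthogonal mA cmu (M := n%:R)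
    (g := fun w => birkhoff_sum theta (innovation A) n (theta w))).
    apply: (measurableT_comp _ mu_before).
    exact: (measurable_birkhoff_sum mu_upto _ (measurable_innovation mA)).
  by move=> w; apply: birkhoff_sum_le; exact: innovation_le1.
Qed.

End consistency.

(** * Uniqueness below an ergodic measure *)

Section excess.
Import numFieldNormedType.Exports.
Context d (T : measurableType d) (R : realType).
Implicit Types mu nu : probability T R.

Definition excess mu nu A : R := fine (nu A) - fine (mu A).

(** The Hahn sets of the charge [nu - mu], described by maximality rather than
    by positivity: this makes stability under a map that preserves both measures
    immediate. *)
Definition max_excess mu nu A :=
  measurable A /\ forall B, measurable B -> excess mu nu B <= excess mu nu A.

Lemma excessDI mu nu A B : measurable A -> measurable B ->
  excess mu nu A = excess mu nu (A `\` B) + excess mu nu (A `&` B).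
Proof.
move=> mA mB; rewrite /excess (measureDI nu mA mB) (measureDI mu mA mB).
by rewrite !fineD ?fin_num_measure//;
  try (exact: measurableD || exact: measurableI); ring.
Qed.

Lemma excessUI mu nu A B : measurable A -> measurable B ->
  excess mu nu (A `|` B) + excess mu nu (A `&` B) = excess mu nu A + excess mu nu B.
Proof.
move=> mA mB; rewrite (excessDI mu nu (measurableU _ _ mA mB) mB).
rewrite (excessDI mu nu mA mB) setIUl setDUl setIid setDv setU0.
by rewrite (_ : A `&` B `|` B = B); [ring|apply/setUidPr; exact: subIsetr].
Qed.

Lemma excessC mu nu A : measurable A -> excess mu nu (~` A) = - excess mu nu A.
Proof.
move=> mA; rewrite /excess !probability_setC// !fineB ?fin_num_measure//=; ring.
Qed.

Lemma excess_swap mu nu A : excess nu mu A = - excess mu nu A.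
Proof. by rewrite /excess; ring. Qed.

(** The excess is modular: the excesses of the union and of the intersection add
    up to twice the maximum, and neither is above it. *)
Lemma max_excessU mu nu A B :
  max_excess mu nu A -> max_excess mu nu B -> max_excess mu nu (A `|` B).
Proof.
move=> [mA hA] [mB hB]; split => [|C mC]; first exact: measurableU.
have := excessUI mu nu mA mB; have := hA _ (measurableI _ _ mA mB).
by have := hA _ mC; have := hB _ mC; lra.
Qed.

Lemma max_excess_setC mu nu A : max_excess mu nu A -> max_excess nu mu (~` A).
Proof.
move=> [mA hA]; split => [|B mB]; first exact: measurableC.
rewrite excessC// !(excess_swap mu nu) opprK.
by have := hA _ (measurableC mB); rewrite excessC.
Qed.

(** The excess is constantly maximal along the increasing finite unions, and
    continuity from below carries its value to the limit. *)
Lemma max_excess_bigcup mu nu (F : (set T)^nat) :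
  (forall n, max_excess mu nu (F n)) -> max_excess mu nu (\bigcup_n F n).
Proof.
move=> hF; have mF n : measurable (F n) by have [] := hF n.
have mUF : measurable (\bigcup_n F n) by exact: bigcup_measurable.
pose G n := \big[setU/set0]_(i < n.+1) F i.
have hG n : max_excess mu nu (G n).
  rewrite /G; elim: n => [|n IH]; first by rewrite big_ord1.
  by rewrite big_ord_recr; exact: max_excessU.
have mG n : measurable (G n) by have [] := hG n.
have UG : \bigcup_n G n = \bigcup_n F n.
  apply/seteqP; split => [x [n _]|x [n _ Fnx]].
    by rewrite /G -bigcup_mkord => -[k _ Fkx]; exists k.
  by exists n => //; rewrite /G -bigcup_mkord; exists n => /=.
have ndG : nondecreasing_seq G.
  move=> m n mn; apply/subsetPset => x.
  rewrite /G -!bigcup_mkord => -[k /= km Fkx]; exists k => //=.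
  exact: leq_trans km _.
have cv (m : probability T R) :
    fine (m (G n)) @[n --> \oo] --> fine (m (\bigcup_n F n)).
  apply: fine_cvg; rewrite fineK ?fin_num_measure//.
  by rewrite -UG; apply: nondecreasing_cvg_mu => //; rewrite UG.
split => // B mB.
have cG : (cst (excess mu nu (G 0%N)) : nat -> R) @ \oo -->
    excess mu nu (\bigcup_n F n).
  rewrite (_ : cst _ = (fun n => fine (nu (G n)) - fine (mu (G n)))).
    exact: (cvgB (cv nu) (cv mu)).
  apply/funext => n; apply/eqP; rewrite eq_le -/(excess mu nu (G n)).
  by rewrite (hG 0%N).2// (hG n).2.
have -> : excess mu nu (\bigcup_n F n) = excess mu nu (G 0%N).
  by apply: (cvg_unique (@Rhausdorff R) cG); exact: cvg_cst.
exact: (hG 0%N).2.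
Qed.

Lemma max_excess_bigcap mu nu (F : (set T)^nat) :
  (forall n, max_excess mu nu (F n)) -> max_excess mu nu (\bigcap_n F n).
Proof.
move=> hF; rewrite -[X in max_excess _ _ X]setCK; apply: max_excess_setC.
by rewrite setC_bigcap; apply: max_excess_bigcup => n; exact: max_excess_setC.
Qed.

Lemma exists_max_excess mu nu : exists A, max_excess mu nu A.
Proof.
pose sigma := cadd (charge_of_finite_measure nu) (copp (charge_of_finite_measure mu)).
have sE A : measurable A -> sigma A = (excess mu nu A)%:E.
  move=> mA; rewrite /excess EFinB !fineK ?fin_num_measure//.
have [P [N [[mP posP] [mN negN] PN _]]] := Hahn_decomposition sigma.
exists P; split => // B mB.
have h1 : excess mu nu (B `\` P) <= 0.
  have mBP := measurableD mB mP.
  rewrite -lee_fin -sE//; apply: negN => // x [_ nPx].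
  by have : [set: T] x by []; rewrite -PN => -[].
have h2 : 0 <= excess mu nu (P `\` B).
  have mPB := measurableD mP mB.
  by rewrite -lee_fin -sE//; apply: posP => // x [].
rewrite (excessDI mu nu mB mP) (excessDI mu nu mP mB) (setIC P).
lra.
Qed.

Variable theta : T -> T.
Hypothesis mtheta : measurable_fun setT theta.

(** The upper limit [Q] of the preimages of a maximal set [P] is maximal and
    strictly invariant, so the excess of [Q] is 0 by ergodicity and domination.
    Thus no set has positive excess and, by complementation, none has a
    negative one. *)
Lemma ergodic_dominated_eq mu nu :
  preserves theta mu -> preserves theta nu -> nu `<< mu ->
  (forall A, measurable A -> theta @^-1` A = A -> mu A = 0%E \/ mu A = 1%E) ->
  forall B, measurable B -> nu B = mu B.
Proof.
move=> imu inu /null_content_dominatesP numu erg.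
have [P [mP hP]] := exists_max_excess mu nu.
have hPn n : max_excess mu nu (iter n theta @^-1` P).
  split => [|B mB].
    by rewrite -[X in measurable X]setTI; exact: measurable_iter.
  by rewrite {2}/excess !(preserves_iter n mtheta)//; exact: hP.
pose Q := \bigcap_n \bigcup_k (iter (n + k) theta @^-1` P).
have [mQ hQ] : max_excess mu nu Q.
  by apply: max_excess_bigcap => n; apply: max_excess_bigcup => k.
have QQ : theta @^-1` Q = Q.
  apply/seteqP; split => x Qx n _.
    have [k _ Pk] := Qx n I; exists k.+1 => //.
    by move: Pk; rewrite /preimage /mkset -iterSr addnS.
  have [k _ Pk] := Qx n.+1 I; exists k => //.
  by rewrite /preimage /mkset -iterSr -addSn.
have Q0 : excess mu nu Q = 0.
  rewrite /excess; have [Q0|Q1] := erg Q mQ QQ.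
    by rewrite Q0 (numu _ mQ Q0) subrr.
  have CQ0 : mu (~` Q) = 0%E by rewrite probability_setC// Q1 subee.
  have := congr1 fine (numu _ (measurableC mQ) CQ0).
  by rewrite probability_setC// Q1 fineB ?fin_num_measure//=; lra.
move=> B mB; have h1 := hQ B mB; have h2 := hQ _ (measurableC mB).
rewrite -(@fineK _ (nu B)) ?fin_num_measure//.
rewrite -(@fineK _ (mu B)) ?fin_num_measure//.
congr EFin; move: h1 h2; rewrite excessC// Q0 /excess; lra.
Qed.

End excess.

(** * Mixtures and conditional measures *)

Section mixtures.
Context d (T : measurableType d) (R : realType).
Implicit Types (s : {i01 R}) (mu nu : probability T R).

Lemma mixE s mu nu A :
  (mix s mu nu A = (s%:num)%:E * mu A + (1 - s%:num)%:E * nu A)%E.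
Proof. by rewrite /mix measure_addE/= /mscale. Qed.

Lemma integral_mix s mu nu (h : T -> \bar R) :
  measurable_fun setT h -> (forall x, 0 <= h x)%E ->
  (\int[mix s mu nu]_x h x =
   (s%:num)%:E * \int[mu]_x h x + (1 - s%:num)%:E * \int[nu]_x h x)%E.
Proof.
move=> mh h0; rewrite ge0_integral_measure_add//.
by rewrite !ge0_integral_mscale.
Qed.

Lemma mix_dominatesl s mu nu : 0 < s%:num -> mu `<< mix s mu nu.
Proof.
move=> s0; apply/null_content_dominatesP => A mA mix0.
have /eqP := etrans (esym (mixE s mu nu A)) mix0.
rewrite padde_eq0 ?mule_ge0// ?lee_fin ?subr_ge0// => /andP[+ _].
by rewrite mule_eq0 eqe gt_eqF//= => /eqP.
Qed.

Lemma mix_dominatesr s mu nu : s%:num < 1 -> nu `<< mix s mu nu.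
Proof.
move=> s1; apply/null_content_dominatesP => A mA mix0.
have /eqP := etrans (esym (mixE s mu nu A)) mix0.
rewrite padde_eq0 ?mule_ge0// ?lee_fin ?subr_ge0// => /andP[_].
by rewrite mule_eq0 eqe subr_eq0 gt_eqF//= => /eqP.
Qed.

Definition conditional mu A (mA : measurable A) : probability T R :=
  mnormalize (mrestr mu mA) mu.

Lemma conditionalE mu A (mA : measurable A) B : mu A != 0%E ->
  conditional mu mA B = (mu (B `&` A) * (fine (mu A))^-1%:E)%E.
Proof.
move=> A0; pose m : {measure set T -> \bar R} := mrestr mu mA.
have mT : m setT = mu A by rewrite /m/= /mrestr setTI.
transitivity (mnormalize m mu B); first by [].
rewrite /mnormalize mT (negbTE A0)/=.
by rewrite lt_eqF// (le_lt_trans (probability_le1 mu mA))// ltry.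
Qed.

Lemma conditional_dominated mu A (mA : measurable A) : mu A != 0%E ->
  conditional mu mA `<< mu.
Proof.
move=> A0; apply/null_content_dominatesP => B mB B0.
rewrite conditionalE// (_ : mu (B `&` A) = 0%E) ?mul0e//.
by apply: (@subset_measure0 _ _ _ mu _ B) => //; exact: measurableI.
Qed.

Lemma mix_conditional s mu A (mA : measurable A) :
  mu A = (s%:num)%:E -> 0 < s%:num < 1 ->
  measure_eq (mix s (conditional mu mA) (conditional mu (measurableC mA))) mu.
Proof.
move=> As /andP[s0 s1] B mB.
have Cs : mu (~` A) = (1 - s%:num)%:E by rewrite probability_setC// As.
have t0 : 0 < 1 - s%:num by rewrite subr_gt0.
rewrite [LHS]mixE !conditionalE ?As ?Cs ?eqe ?gt_eqF//=.
rewrite muleCA -EFinM divff ?gt_eqF// mule1.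
rewrite muleCA -EFinM divff ?gt_eqF// mule1.
by rewrite [RHS](measureDI mu mB mA) setDE addeC.
Qed.

End mixtures.

(** * Extreme points and faces *)

Section invariance.
Context d (E : measurableType d) (Omega : admissible E) (R : realType).
Let tau := @shift_config _ E Omega.

Lemma shift_config_inj : injective tau.
Proof.
move=> v w vw; apply/val_inj/funext => i.
have := congr1 (fun u : config Omega => config_fun u (i + 1)) vw.
rewrite -![tau _]/(iter 1 tau _) !config_fun_iter_shift.
by rewrite addrK.
Qed.

Lemma shift_config_surj (w : config Omega) : exists v, tau v = w.
Proof.
have := set_valP w; rewrite -[X in X _](config_shift Omega) => -[v Omv vw].
exists (exist _ v (mem_set Omv)); apply: val_inj; exact: vw.
Qed.

Lemma shift_invariantP (A : set (config Omega)) :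
  tau @` A = A <-> tau @^-1` A = A.
Proof.
split => tA.
  by rewrite -{1}tA; apply/seteqP; split =>
    [w [v Av /shift_config_inj <-]//|w Aw]; exists w.
rewrite -{1}tA; apply/seteqP; split => [w [v Av <-]//|w Aw].
by have [v vw] := shift_config_surj w; exists v => //; rewrite /preimage/= vw.
Qed.

Lemma conditional_Pinv (mu : probability (config Omega) R) A
    (mA : measurable A) :
  mu A != 0%E -> Pinv mu -> tau @^-1` A = A -> Pinv (conditional mu mA).
Proof.
move=> A0 imu tA B mB; rewrite /pushforward !conditionalE//; congr (_ * _)%E.
by rewrite -{1}tA -preimage_setI; apply: imu; exact: measurableI.
Qed.

Lemma mix_Pinv s (mu nu : probability (config Omega) R) :
  Pinv mu -> Pinv nu -> Pinv (mix s mu nu).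
Proof.
move=> imu inu A mA; rewrite /pushforward [LHS]mixE [RHS]mixE.
by have := imu A mA; have := inu A mA; rewrite /pushforward => -> ->.
Qed.

Variables (f : kernel_family Omega R) (f_lis : is_lis f).

Lemma Ginv_face : is_face (@Pinv _ E Omega R) (Ginv f).
Proof.
split => [mu []//|mu nu s [cmu imu] [cnu inu]|mu nu s imu inu /andP[s0 s1] G].
  split; last exact: mix_Pinv.
  move=> L A mA; rewrite integral_mix//; first by rewrite cmu// cnu// [RHS]mixE.
  exact: measurable_kernel.
by split; apply: (Ginv_dominated f_lis G) => //;
  [exact: mix_dominatesl|exact: mix_dominatesr].
Qed.

(** An invariant set of measure strictly between 0 and 1 splits [mu] into its
    two conditional measures, which are in [Ginv f] by [Ginv_dominated].
    Extremality would make the one on [A] equal to [mu], but it gives [A]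
    measure 1. *)
Lemma extreme_ergodic (mu : probability (config Omega) R) :
  Ginv f mu -> extreme_point (Ginv f) mu -> ergodic mu.
Proof.
move=> G [_ ext]; split => [|A [mA /shift_invariantP tA]]; first by case: G.
have [A0|A0] := eqVneq (mu A) 0%E; [by left|right].
apply/eqP; apply: contraT => A1.
have fA : (fine (mu A))%:E = mu A by rewrite fineK ?fin_num_measure.
have Age0 : 0 <= fine (mu A) by rewrite fine_ge0.
have Ale1 : fine (mu A) <= 1 by rewrite -lee_fin fA probability_le1.
have sI : Itv.spec (@Itv.num_sem R) (Itv.Real `[0%Z, 1%Z]) (fine (mu A)).
  by apply/and3P; split => //=; rewrite ?num_real.
pose s : {i01 R} := Itv.mk sI.
have s01 : 0 < s%:num < 1.
  have -> : s%:num = fine (mu A) by [].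
  apply/andP; split; rewrite lt_neqAle ?Age0 ?Ale1 andbT -eqe fA//.
  by rewrite eq_sym.
have muA : mu A = (s%:num)%:E by rewrite -fA.
have CA0 : mu (~` A) != 0%E.
  by rewrite probability_setC// sube_eq ?fin_num_measure// ?add0e; rewrite eq_sym.
have tC : tau @^-1` (~` A) = ~` A by rewrite -preimage_setC tA.
have imu : Pinv mu by case: G.
have G1 : Ginv f (conditional mu mA).
  apply: (Ginv_dominated f_lis G); last exact: conditional_dominated.
  exact: conditional_Pinv.
have G2 : Ginv f (conditional mu (measurableC mA)).
  apply: (Ginv_dominated f_lis G); last exact: conditional_dominated.
  exact: conditional_Pinv.
have [condA _] := ext _ _ s G1 G2 s01 (mix_conditional mA muA s01).
have := etrans (esym (conditionalE mA A A0)) (condA A mA).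
rewrite setIid -fA -EFinM divff ?fA; last by rewrite -eqe fA.
by move=> /esym/eqP; rewrite (negbTE A1).
Qed.

Lemma ergodic_extreme (mu : probability (config Omega) R) :
  Ginv f mu -> ergodic mu -> extreme_point (Ginv f) mu.
Proof.
move=> G [imu erg]; split => // nu1 nu2 s [_ i1] [_ i2] /andP[s0 s1] mixmu.
have uniq (nu : probability (config Omega) R) : Pinv nu ->
    nu `<< mix s nu1 nu2 -> measure_eq nu mu.
  move=> inu /null_content_dominatesP numu B mB.
  apply: (ergodic_dominated_eq (theta := tau)) => //.
  - exact: measurable_shift.
  - apply/null_content_dominatesP => A mA A0; apply: numu => //.
    exact: etrans (mixmu A mA) A0.
  - move=> A mA tA; apply: erg; split => //; exact/shift_invariantP.
by split; apply: uniq => //; [exact: mix_dominatesl|exact: mix_dominatesr].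
Qed.

End invariance.

Theorem theorem3p9 (d : measure_display) (E : measurableType d)
    (Omega : admissible E) (R : realType) (f : kernel_family Omega R)
    (f_lis : is_lis f) (f_inv : lis_shift_invariant f) :
  [/\ forall mu : probability (config Omega) R, Ginv f mu ->
        (extreme_point (Ginv f) mu <-> ergodic mu),
      forall mu nu : probability (config Omega) R, Ginv f mu -> Pinv nu ->
        nu `<< mu -> Ginv f nu &
      is_face (@Pinv _ E Omega R) (Ginv f)].
Proof.
split; last exact: Ginv_face.
- by move=> mu G; split; [exact: extreme_ergodic|exact: ergodic_extreme].
- exact: Ginv_dominated.
Qed.
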